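(* Consider two DtACI procedures (dynamically-tuned adaptive conformal inference, defined in the context) run separately in parallel, one for the lower tail (sign $-$) and one for the upper tail (sign $+$), with target levels $\alpha^-,\alpha^+\in(0,1)$, the same grid of candidate step sizes $\{\gamma_j\}_{j=1}^k$, $\gamma_j>0$, but possibly different learning-rate sequences $\{\eta_i^\pm\}_{i\ge1}$ and mixing sequences $\{\sigma_i^\pm\}_{i\ge1}$. Assume that the conformity score functions are quasi-convex in $y$, and that the empirical quantile functions $\widehat Q^{L}_i,\widehat Q^{U}_i$ are non-decreasing, equal to $-\infty$ on $(-\infty,0)$ and to $+\infty$ on $(1,\infty)$. Put $\gamma_{\min}:=\min_j\gamma_j$, $\gamma_{\max}:=\max_j\gamma_j$, let $$\mathrm{err}_i^{\mathrm{tot}}:=\mathrm{err}_i^-+\mathrm{err}_i^+,\qquad \alpha^{\mathrm{tot}}:=\alpha^-+\alpha^+$$ be the observed and target miscoverage of the intersection interval $\mathcal C^{\cap}_{i,\underline\alpha_i}=\mathcal C^{L}_{i,\alpha_i^-}\cap\mathcal C^{U}_{i,\alpha_i^+}$, $\underline\alpha_i=(\alpha_i^-,\alpha_i^+)$, and define $$\tilde\alpha_i^\pm:=\sum_{l=1}^k\frac{p_i^{l,\pm}\alpha_i^{l,\pm}}{\gamma_l},\qquad \tilde\alpha_i^{\mathrm{tot}}:=\tilde\alpha_i^-+\tilde\alpha_i^+,\qquad B_0:=\max\left\{\tilde\alpha_1^{\mathrm{tot}}+\frac{2\gamma_{\max}}{\gamma_{\min}},\ \frac{2+2\gamma_{\max}}{\gamma_{\min}}-\tilde\alpha_1^{\mathrm{tot}}\right\}.$$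 Then, for every $N\in\mathbb N$ ($N\ge1$), $$\left|\frac1N\sum_{i=1}^N\mathbb E[\mathrm{err}_i^{\mathrm{tot}}]-\alpha^{\mathrm{tot}}\right|\le\frac{B_0}{N}+\frac{(1+2\gamma_{\max})^2}{\gamma_{\min}}\cdot\frac1N\sum_{i=1}^N\Big[\eta_i^-e^{\eta_i^-(1+2\gamma_{\max})}+\eta_i^+e^{\eta_i^+(1+2\gamma_{\max})}\Big]+2\,\frac{1+\gamma_{\max}}{\gamma_{\min}}\cdot\frac1N\sum_{i=1}^N(\sigma_i^-+\sigma_i^+),$$ where the expectation $\mathbb E$ is only over the random selection of levels according to the DtACI aggregation probabilities $\{p_i^{j,\pm}\}_{j=1}^k$. In particular, if $\eta_i^\pm\to0$ and $\sigma_i^\pm\to0$ as $i\to\infty$, then $\frac1N\sum_{i=1}^N\mathrm{err}_i^{\mathrm{tot}}\to\alpha^{\mathrm{tot}}$ almost surely as $N\to\infty$. When $\eta_i^-=\eta_i^+=:\eta_i$ and $\sigma_i^-=\sigma_i^+=:\sigma_i$ for all $i$, the bound becomes $$\left|\frac1N\sum_{i=1}^N\mathbb E[\mathrm{err}_i^{\mathrm{tot}}]-\alpha^{\mathrm{tot}}\right|\le\frac{B_0}{N}+2\,\frac{(1+2\gamma_{\max})^2}{\gamma_{\min}}\frac1N\sum_{i=1}^N\eta_ie^{\eta_i(1+2\gamma_{\max})}+4\,\frac{1+\gamma_{\max}}{\gamma_{\min}}\frac1N\sum_{i=1}^N\sigma_i.$$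
   Context: Data and prediction sets. The online data are an arbitrary sequence of random pairs $(X_i,Y_i)_{i\ge1}$ with $X_i\in\mathbb R^p$, $Y_i\in\mathbb R$ (no exchangeability assumed; indexed from $1$ after an initial sample used for initialization). At each time $i$, from past data one has real-valued lower and upper conformity score functions $s_i^L(x,y)$, $s_i^U(x,y)$ and empirical quantile functions $\widehat Q_i^L,\widehat Q_i^U:\mathbb R\to[-\infty,+\infty]$. For $a\in\mathbb R$, $$\mathcal C^{L}_{i,a}=\{y: s_i^L(X_i,y)\le\widehat Q_i^L(1-a)\},\qquad \mathcal C^{U}_{i,a}=\{y: s_i^U(X_i,y)\le\widehat Q_i^U(1-a)\};$$ these are intervals of the form $[L,\infty)$ and $(-\infty,U]$ respectively (possibly degenerate: $\mathbb R$ or empty). Below, for sign $-$ write $\mathcal C^{-}=\mathcal C^{L}$ and for sign $+$ write $\mathcal C^{+}=\mathcal C^{U}$. DtACI procedure for sign $\pm$ with target $\alpha^\pm$, grid $\{\gamma_j\}_{j=1}^k$, deterministic parameters $\eta_i^\pm>0$, $\sigma_i^\pm\in(0,1)$. Initialize $w_1^{j,\pm}=1$ and $\alpha_1^{j,\pm}=\alpha^\pm$ for $j=1,\dots,k$. At each $i\ge1$: 1. $p_i^{j,\pm}=w_i^{j,\pm}/\sum_{l=1}^kw_i^{l,\pm}$. 2. Draw $\alpha_i^\pm$ from $\{\alpha_i^{j,\pm}\}_{j=1}^k$, choosing index $j$ with probability $p_i^{j,\pm}$ (fresh independent randomness at each time and for each tail, given the data), and set $\mathrm{err}_i^\pm=\mathbf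 1\{Y_i\notin\mathcal C^{\pm}_{i,\alpha_i^\pm}\}$. 3. $\beta_i^\pm=\sup\{\beta\in[0,1]:Y_i\in\mathcal C^{\pm}_{i,\beta}\}$ (with $\sup\emptyset=0$). 4. With the pinball loss $\ell(\beta,a)=\alpha^\pm(\beta-a)-\min\{0,\beta-a\}$, set $\tilde w_i^{j,\pm}=w_i^{j,\pm}\exp(-\eta_i^\pm\,\ell(\beta_i^\pm,\alpha_i^{j,\pm}))$ and $w_{i+1}^{j,\pm}=(1-\sigma_i^\pm)\tilde w_i^{j,\pm}+\frac{\sigma_i^\pm}{k}\sum_{l=1}^k\tilde w_i^{l,\pm}$. 5. $\mathrm{err}_i^{j,\pm}=\mathbf 1\{Y_i\notin\mathcal C^{\pm}_{i,\alpha_i^{j,\pm}}\}$ and $\alpha_{i+1}^{j,\pm}=\alpha_i^{j,\pm}+\gamma_j(\alpha^\pm-\mathrm{err}_i^{j,\pm})$. Thus $\mathbb E[\mathrm{err}_i^\pm]=\sum_{j=1}^kp_i^{j,\pm}\mathrm{err}_i^{j,\pm}$ and $\mathbb E[\mathrm{err}_i^{\mathrm{tot}}]=\mathbb E[\mathrm{err}_i^-]+\mathbb E[\mathrm{err}_i^+]$, which are functions of the data; the displayed bounds hold for every realization of the data. *)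

(* Defs.v *)
From mathcomp Require Import all_boot all_order all_algebra.
From mathcomp Require Import all_classical all_reals all_analysis.
From mathcomp Require Import measurable_realfun.
Import Order.TTheory GRing.Theory Num.Theory.
Import numFieldNormedType.Exports.

Set Implicit Arguments.
Unset Strict Implicit.
Unset Printing Implicit Defensive.

Local Open Scope classical_set_scope.
Local Open Scope ring_scope.

(* Conventions.
   - Online times are numbered from 0: index [i] stands for time [i + 1], so
     [\sum_(i < N)] is the sum over times 1, ..., N and index 0 is time 1.
   - The grid of step sizes has [k.+1] elements, so it is never empty.
   - A tail is a boolean: [lower] is the sign -, [upper] is the sign +. *)

Definition lower : bool := false.
Definition upper : bool := true.

(* One DtACI run, for one tail and one realization of the data: [cset i a] is
   the prediction set of level [a] and [obs i] the response at time [i]. *)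
Record dtaci (R : realType) (k : nat) := Dtaci {
  target : R;
  step : 'I_k.+1 -> R;
  lrate : nat -> R;
  mixing : nat -> R;
  cset : nat -> R -> set R;
  obs : nat -> R
}.

Section DtACI.
Variables (R : realType) (k : nat) (D : dtaci R k).

Definition miss (i : nat) (a : R) : R := \1_(~` cset D i a) (obs D i).

Fixpoint level (i : nat) (j : 'I_k.+1) : R :=
  if i is i'.+1
  then level i' j + step D j * (target D - miss i' (level i' j))
  else target D.

(* [sup set0 = 0] in the library. *)
Definition beta (i : nat) : R :=
  sup [set b : R | 0 <= b <= 1 /\ cset D i b (obs D i)].

Definition pinball (b a : R) : R := target D * (b - a) - Num.min 0 (b - a).

Fixpoint weight (i : nat) (j : 'I_k.+1) : R :=
  if i is i'.+1
  then let wtilde l :=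
         weight i' l * expR (- lrate D i' * pinball (beta i') (level i' l)) in
       (1 - mixing D i') * wtilde j
       + mixing D i' / k.+1%:R * \sum_l wtilde l
  else 1.

Definition prob (i : nat) (j : 'I_k.+1) : R := weight i j / \sum_l weight i l.

Definition scaled_level (i : nat) : R :=
  \sum_l prob i l * level i l / step D l.

End DtACI.

(* Expectation of [f j l] over independent indices [j], [l] with
   probabilities [p] and [q]. *)
Definition sel_expect (R : realType) (k : nat) (p q : 'I_k.+1 -> R)
    (f : 'I_k.+1 -> 'I_k.+1 -> R) : R :=
  \sum_j \sum_l p j * q l * f j l.

Definition grid_min (R : realType) (k : nat) (g : 'I_k.+1 -> R) : R :=
  \big[Num.min/g ord0]_j g j.

Definition grid_max (R : realType) (k : nat) (g : 'I_k.+1 -> R) : R :=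
  \big[Num.max/g ord0]_j g j.

Definition quasi_convex (R : realType) (f : R -> R) : Prop :=
  forall (y z c : R), 0 <= c <= 1 ->
    f (c * y + (1 - c) * z) <= Num.max (f y) (f z).

(* Rays of the form [L, +oo) (lower tail) or (-oo, U] (upper tail), including
   the degenerate ones. *)
Definition closed_ray (R : realType) (t : bool) (C : set R) : Prop :=
  C = set0 \/ C = setT \/
  exists b : R, C = if t then [set y | y <= b] else [set y | b <= y].

Definition conformal_set (R : realType) (p : nat) (s : 'rV[R]_p -> R -> R)
    (Q : R -> \bar R) (x : 'rV[R]_p) (a : R) : set R :=
  [set y | ((s x y)%:E <= Q (1 - a)%R)%E].

Section Data.
Variables (R : realType) (p n0 : nat) (T : Type).
Variables (X : nat -> T -> 'rV[R]_p) (Y : nat -> T -> R).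

(* The first [n0] observations are the initial sample, so that the pair
   observed at time [i] is number [n0 + i] and is not part of the past. *)
Definition past (i : nat) (w : T) : seq ('rV[R]_p * R) :=
  [seq (X m w, Y m w) | m <- iota 0 (n0 + i)].

(* The sigma-algebra generated by the whole data sequence (the Borel
   sigma-algebra of R^p being generated by the coordinates). *)
Definition data_cylinders : set (set T) :=
  \bigcup_m (preimage_set_system setT (Y m) measurable `|`
    \bigcup_c preimage_set_system setT (fun w => X m w ord0 c) measurable).

Definition data_sigma : set (set T) := <<s data_cylinders >>.

Definition data_measurable d (U : sigmaRingType d) (f : T -> U) : Prop :=
  forall B, measurable B -> data_sigma (f @^-1` B).

End Data.

(* Main.v *)
Require Import Defs.
From mathcomp Require Import all_boot all_order all_algebra.
From mathcomp Require Import all_classical all_reals all_analysis.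
From mathcomp Require Import measurable_realfun.
From mathcomp Require Import ring lra zify.
Import Order.TTheory GRing.Theory Num.Theory.
Import numFieldNormedType.Exports.

(* Deterministic bound: for one tail, the average of level/step under the
   selection probabilities p_i moves by target - E[err_i] when the levels are
   updated with p_i kept fixed, so E[err_i] - target telescopes up to the effect
   of replacing p_i by p_(i+1).  The exponential reweighting moves p_i by a
   factor within exp(+-x) of 1, x = lrate (1 + 2 gmax), and the mixing moves it
   by at most 2 mixing in l^1; levels stay in [-step, 1 + step] because the
   prediction set is everything below level 0 and empty above level 1.

   Almost sure convergence: err_i - E[err_i] is a finite sum over tails and
   indices j of err_i^j (1{J_i = j} - p_i^j).  Given the data these terms are
   bounded and pairwise orthogonal, so their averages vanish almost surely (along
   squares by summability of second moments, then in between by boundedness).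
   Orthogonality rests on the measurability of err_i^j and p_i^j in the data. *)

Set Implicit Arguments.
Unset Strict Implicit.
Unset Printing Implicit Defensive.

Local Open Scope classical_set_scope.
Local Open Scope ring_scope.

(** * Drift of the scaled levels *)

(** Hölder's inequality between l^1 and l^infinity. It is used with [u] a difference of probability
    vectors and [c] the scaled levels. *)
Lemma ler_sum_norm_mul (R : realDomainType) (I : finType) (u c : I -> R)
    (b : I -> R) (K : R) :
  0 <= K -> (forall i, `|u i| <= b i) -> (forall i, `|c i| <= K) ->
  `|\sum_i u i * c i| <= (\sum_i b i) * K.
Proof.
move=> K0 ub cK; rewrite (le_trans (ler_norm_sum _ _ _))// mulr_suml.
by apply: ler_sum => i _; rewrite normrM ler_pM.
Qed.

Lemma expR_sub1_le (R : realType) (x : R) : expR x - 1 <= x * expR x.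
Proof.
have := expR_ge1Dx (- x); rewrite expRN => h.
have e0 := expR_gt0 x.
have : (1 - x) * expR x <= 1.
  by rewrite -[leRHS](mulVf (lt0r_neq0 e0)) ler_wpM2r// ltW.
by lra.
Qed.

Section Grid.
Variables (R : realType) (k : nat) (g : 'I_k.+1 -> R).
Hypothesis g_gt0 : forall j, 0 < g j.

Lemma grid_min_le j : grid_min g <= g j.
Proof. exact: bigmin_le. Qed.

Lemma grid_max_ge j : g j <= grid_max g.
Proof. exact: le_bigmax. Qed.

Lemma grid_min_gt0 : 0 < grid_min g.
Proof. by rewrite /grid_min; apply: lt_bigmin. Qed.

Lemma grid_max_gt0 : 0 < grid_max g.
Proof. exact: lt_le_trans (g_gt0 ord0) (grid_max_ge ord0). Qed.

End Grid.

Section Drift.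
Variables (R : realType) (k : nat) (D : dtaci R k).
Hypothesis target01 : 0 < target D < 1.
Hypothesis step_gt0 : forall j, 0 < step D j.
Hypothesis lrate_gt0 : forall i, 0 < lrate D i.
Hypothesis mixing01 : forall i, 0 < mixing D i < 1.
Hypothesis miss_lt0 : forall i a, a < 0 -> miss D i a = 0.
Hypothesis miss_gt1 : forall i a, 1 < a -> miss D i a = 1.

Local Notation gmin := (grid_min (step D)).
Local Notation gmax := (grid_max (step D)).

Lemma miss01 i a : 0 <= miss D i a <= 1.
Proof. by rewrite /miss indicE; case: (_ \in _) => /=; lra. Qed.

(** Below 0 nothing is missed, so the level rises by [step * target]. Above 1 everything is missed,
    so it falls. From within [0, 1] one move has length at most [step], so the overshoot never
    exceeds one step. *)
Lemma level_bound i j : - step D j <= level D i j <= 1 + step D j.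
Proof.
have s0 := step_gt0 j; have /andP[t0 t1] := target01.
elim: i => [|i ih] /=; first by apply/andP; split; lra.
have m01 := miss01 i (level D i j); have h0 := @miss_lt0 i (level D i j).
have h1 := @miss_gt1 i (level D i j).
move: (level D i j) (miss D i _) ih h0 h1 m01 => a m /andP[a_lb a_ub] h0 h1 m01.
have /andP[st0 st1] : 0 <= step D j * target D <= step D j.
  by rewrite ler_piMr ?mulr_ge0// ltW.
have /andP[m0 m1] := m01; have /andP[sm0 sm1] : 0 <= step D j * m <= step D j.
  by rewrite ler_piMr ?mulr_ge0// ltW.
rewrite mulrBr; case: (ltP a 0) => [/h0 mE|a0].
  by rewrite mE mulr0; apply/andP; split; lra.
by case: (ltP 1 a) => [/h1 mE|a1]; rewrite ?mE ?mulr1; apply/andP; split; lra.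
Qed.

Lemma beta01 i : 0 <= beta D i <= 1.
Proof.
rewrite /beta; set B := [set b | _]; have [->|/set0P[b Bb]] := eqVneq B set0.
  by rewrite sup0 lexx ler01.
have ubB : ubound B 1 by move=> c [/andP[]].
apply/andP; split; last by apply: ge_sup => //; exists b.
have := Bb => -[/andP[b0 _] _]; apply: le_trans b0 _.
by apply: ub_le_sup => //; exists 1.
Qed.

(** [beta] is within 1 + gmax of every level, and the loss has slopes at most 1 in absolute value.
    The looser 1 + 2 gmax is the constant of the final bound. *)
Lemma pinball_bound i j :
  0 <= pinball D (beta D i) (level D i j) <= 1 + 2 * gmax.
Proof.
have /andP[b0 b1] := beta01 i; have /andP[l0 l1] := level_bound i j.
have sG := grid_max_ge (step D) j; have s0 := step_gt0 j.
have /andP[t0 t1] := target01; rewrite /pinball.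
move: (beta D i) (level D i j) (step D j) gmax (target D) => b a s G t
  in b0 b1 l0 l1 sG s0 t0 t1 *.
by case: (leP 0 (b - a)) => h; apply/andP; split; nra.
Qed.

(** The weights after exponential reweighting and before mixing. *)
Definition tilted i j :=
  weight D i j * expR (- lrate D i * pinball D (beta D i) (level D i j)).

Lemma weightS i j : weight D i.+1 j =
  (1 - mixing D i) * tilted i j + mixing D i / k.+1%:R * \sum_l tilted i l.
Proof. by []. Qed.

Lemma weight_gt0 i j : 0 < weight D i j.
Proof.
elim: i j => [|i ih] j; first exact: ltr01.
have /andP[s0 s1] := mixing01 i.
rewrite weightS ltr_wpDr//.
  apply: mulr_ge0; first by rewrite divr_ge0// ltW.
  by apply: sumr_ge0 => l _; rewrite mulr_ge0 ?expR_ge0// ltW.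
by rewrite !mulr_gt0 ?expR_gt0// subr_gt0.
Qed.

Lemma sum_ord_gt0 (f : 'I_k.+1 -> R) :
  (forall j, 0 < f j) -> 0 < \sum_j f j.
Proof.
by move=> f0; rewrite big_ord_recl ltr_pwDl// sumr_ge0// => j _; exact: ltW.
Qed.

Lemma tilted_gt0 i j : 0 < tilted i j.
Proof. by rewrite mulr_gt0 ?weight_gt0 ?expR_gt0. Qed.

(** Mixing redistributes mass without changing the total, so the next probabilities and the tilted
    ones share one normalizer. *)
Lemma sum_weightS i : \sum_j weight D i.+1 j = \sum_j tilted i j.
Proof.
under eq_bigr do rewrite weightS.
rewrite big_split/= -mulr_sumr sumr_const card_ord -mulr_natl.
set S := \sum_j _; have k0 : k.+1%:R != 0 :> R by rewrite pnatr_eq0.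
by field.
Qed.

Lemma prob_ge0 i j : 0 <= prob D i j.
Proof.
by rewrite divr_ge0 ?sumr_ge0// => [|l _]; rewrite ltW// weight_gt0.
Qed.

Lemma sum_prob i : \sum_j prob D i j = 1.
Proof.
rewrite -mulr_suml divff// gt_eqF// sum_ord_gt0//; exact: weight_gt0.
Qed.

Lemma prob_le1 i j : prob D i j <= 1.
Proof.
rewrite -(sum_prob i) (bigD1 j)//= lerDl.
by apply: sumr_ge0 => l _; exact: prob_ge0.
Qed.

Definition tilted_prob i j := tilted i j / \sum_l tilted i l.

Lemma sum_tilted_prob i : \sum_j tilted_prob i j = 1.
Proof.
rewrite -mulr_suml divff// gt_eqF// sum_ord_gt0//; exact: tilted_gt0.
Qed.

Lemma tilted_prob_ge0 i j : 0 <= tilted_prob i j.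
Proof.
by rewrite divr_ge0 ?sumr_ge0// => [|l _]; rewrite ltW// tilted_gt0.
Qed.

Lemma probS i j :
  prob D i.+1 j = (1 - mixing D i) * tilted_prob i j + mixing D i / k.+1%:R.
Proof.
have S0 : 0 < \sum_l tilted i l by rewrite sum_ord_gt0//; exact: tilted_gt0.
rewrite /prob sum_weightS weightS /tilted_prob.
have k0 : k.+1%:R != 0 :> R by rewrite pnatr_eq0.
move: (\sum_l _) (k.+1%:R : R) S0 k0 => S n S0 k0; field.
by rewrite k0 gt_eqF.
Qed.

(* The reweighting factors lie in [exp(-x), 1], hence so does their average,
   and each normalized factor lies in [exp(-x), exp(x)]. *)
Lemma tilted_prob_dist i j (x := lrate D i * (1 + 2 * gmax)) :
  `|tilted_prob i j - prob D i j| <= prob D i j * (x * expR x).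
Proof.
set e := fun l => expR (- lrate D i * pinball D (beta D i) (level D i l)).
have e_bd l : expR (- x) <= e l <= 1.
  have /andP[p0 p1] := pinball_bound i l; have l0 := lrate_gt0 i.
  apply/andP; split; first by rewrite ler_expR mulNr lerN2 ler_pM2l.
  by rewrite /e -expR0 ler_expR mulNr oppr_le0 mulr_ge0// ltW.
set W := \sum_l weight D i l; set V := \sum_l tilted i l.
have W0 : 0 < W by rewrite sum_ord_gt0//; exact: weight_gt0.
have V0 : 0 < V by rewrite sum_ord_gt0//; exact: tilted_gt0.
have VW : V <= W.
  apply: ler_sum => l _; have /andP[_ ?] := e_bd l.
  by rewrite ler_piMr// ltW// weight_gt0.
have WV : expR (- x) * W <= V.
  rewrite mulr_sumr; apply: ler_sum => l _; have /andP[? _] := e_bd l.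
  by rewrite mulrC ler_pM2l// weight_gt0.
have /andP[ej0 ej1] := e_bd j.
have E0 := expR_gt0 x; have xE : expR x * expR (- x) = 1 by rewrite expRxMexpNx_1.
have qE : tilted_prob i j - prob D i j = prob D i j * (e j * W / V - 1).
  rewrite /tilted_prob /prob -/W -/V /tilted -/(e j).
  by field; rewrite !gt_eqF.
rewrite qE normrM (ger0_norm (prob_ge0 i j)) ler_wpM2l ?prob_ge0//.
apply: le_trans (expR_sub1_le x).
have ub : e j * W / V <= expR x.
  rewrite ler_pdivrMr//; apply: (@le_trans _ _ W); first by rewrite ler_piMl// ltW.
  by rewrite -[leLHS]mul1r -xE -mulrA ler_pM2l.
have lb : expR (- x) <= e j * W / V.
  rewrite ler_pdivlMr//; by apply: ler_pM => //; rewrite ?expR_ge0 ?ltW.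
rewrite ler_norml lerD2r ub andbT.
(* The lower side needs 1 - exp(-x) <= exp(x) - 1, that is E + F >= 2 for positive E, F with E F =
   1. *)
apply: le_trans (lerB lb (lexx 1)).
move: (expR_gt0 (- x)) => F0.
have := sqr_ge0 (expR x - expR (- x)); have := sqr_ge0 (expR x - 1).
move: (expR x) (expR (- x)) E0 F0 xE => E F E0 F0 EF *; nra.
Qed.

Lemma level_step_bound i j :
  - (gmax / gmin) <= level D i j / step D j <= (1 + gmax) / gmin.
Proof.
have g0 := grid_min_gt0 step_gt0; have := grid_min_le (step D) j.
have := grid_max_ge (step D) j; have s0 := step_gt0 j => sM sm.
have /andP[l0 l1] := level_bound i j.
(* Replacing the denominator by gmin is only valid under a nonnegative numerator bound. The lower
   bound therefore comes from the upper bound on the negated level. *)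
have cross a b : 0 <= b -> a <= b -> a / step D j <= b / gmin.
  move=> b0 ab; apply: (@le_trans _ _ (b / step D j)).
    by rewrite ler_pM2r ?invr_gt0.
  by rewrite ler_wpM2l// lef_pV2.
rewrite lerNl -mulNr !cross//; lra.
Qed.

Lemma norm_level_step i j : `|level D i j / step D j| <= (1 + gmax) / gmin.
Proof.
have /andP[l0 l1] := level_step_bound i j.
rewrite ler_norml l1 andbT; apply: le_trans l0; rewrite lerN2.
have g0 := grid_min_gt0 step_gt0.
by rewrite ler_pM2r ?invr_gt0// lerDr.
Qed.

(** The expectation of err_i for one tail over the selection, as a function of the data. *)
Definition mean_miss i := \sum_j prob D i j * miss D i (level D i j).

(** Dividing the update of each level by its own step leaves the increment target - err_i^j, free of
    the step. Its average under p_i is target - E[err_i], and the remaining sum is the cost of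
    passing from p_i to p_(i+1). *)
Lemma scaled_levelS i : mean_miss i - target D =
  scaled_level D i - scaled_level D i.+1 +
  \sum_j (prob D i.+1 j - prob D i j) * (level D i.+1 j / step D j).
Proof.
have -> : target D = \sum_j prob D i j * target D.
  by rewrite -mulr_suml sum_prob mul1r.
rewrite /mean_miss /scaled_level -!sumrB -big_split/=.
by apply: eq_bigr => j _; have := step_gt0 j => /gt_eqF s0; field; rewrite s0.
Qed.

Definition drift i :=
  (1 + 2 * gmax) ^+ 2 / gmin * (lrate D i * expR (lrate D i * (1 + 2 * gmax)))
  + 2 * ((1 + gmax) / gmin) * mixing D i.

Lemma prob_drift i :
  `|\sum_j (prob D i.+1 j - prob D i j) * (level D i.+1 j / step D j)|
  <= drift i.
Proof.
set K := (1 + gmax) / gmin; set c := fun j => level D i.+1 j / step D j.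
have g0 := grid_min_gt0 step_gt0; have M0 := grid_max_gt0 step_gt0.
have cK j : `|c j| <= K := norm_level_step i.+1 j.
have K0 : 0 <= K := le_trans (normr_ge0 _) (cK ord0).
have /andP[s0 s1] := mixing01 i.
pose x := lrate D i * (1 + 2 * gmax).
(* Split p_(i+1) - p_i at the tilted probabilities: first the reweighting, then the pull of the
   mixing towards the uniform distribution. *)
have -> : \sum_j (prob D i.+1 j - prob D i j) * c j =
    \sum_j (tilted_prob i j - prob D i j) * c j +
    mixing D i * \sum_j (k.+1%:R^-1 - tilted_prob i j) * c j.
  rewrite mulr_sumr -big_split/=; apply: eq_bigr => j _.
  by rewrite probS; move: (k.+1%:R^-1 : R) (c j) => n cj; ring.
rewrite (le_trans (ler_normD _ _))// /drift -/x lerD//.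
  apply: (@le_trans _ _ (x * expR x * K)).
    rewrite -[X in _ <= X * _]mul1r -[X in X * (_ * _)](sum_prob i) mulr_suml.
    by apply: ler_sum_norm_mul => // j; exact: tilted_prob_dist.
  (* With the common factor [y] taken out, only 1 + gmax <= 1 + 2 gmax remains to be compared. *)
  pose y := (1 + 2 * gmax) / gmin * (lrate D i * expR x).
  have -> : x * expR x * K = (1 + gmax) * y by rewrite /x /K /y; ring.
  have -> : (1 + 2 * gmax) ^+ 2 / gmin * (lrate D i * expR x) =
    (1 + 2 * gmax) * y by rewrite /y; ring.
  apply: ler_wpM2r; last by lra.
  by rewrite !mulr_ge0 ?expR_ge0 ?invr_ge0 ?ltW//; lra.
rewrite normrM (gtr0_norm s0) [leRHS]mulrC ler_pM2l//.
(* Two probability vectors are at l^1 distance at most 2: each coordinate of the difference is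
   bounded by the sum of the two entries. *)
have -> : 2 * K = (\sum_(j < k.+1) (k.+1%:R^-1 + tilted_prob i j)) * K.
  rewrite big_split/= sum_tilted_prob sumr_const card_ord.
  by rewrite -(mulr_natl (k.+1%:R^-1)) divff ?pnatr_eq0.
apply: ler_sum_norm_mul => // j.
rewrite (le_trans (ler_normB _ _))// !ger0_norm ?tilted_prob_ge0//.
Qed.

Lemma sum_mean_miss N :
  `|\sum_(i < N) (mean_miss i - target D) -
    (scaled_level D 0 - scaled_level D N)| <= \sum_(i < N) drift i.
Proof.
elim: N => [|N ih]; first by rewrite !big_ord0 subrr subrr normr0.
rewrite !big_ord_recr/= scaled_levelS.
set s := \sum_j _; apply: le_trans (lerD ih (prob_drift N)).
by apply: le_trans (ler_normD _ _); rewrite le_eqVlt; apply/orP; left; apply/eqP;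
  congr `| _ |; rewrite /s; ring.
Qed.

Lemma scaled_level_bound i :
  - (gmax / gmin) <= scaled_level D i <= (1 + gmax) / gmin.
Proof.
have mean_cst (c : R) : c = \sum_j prob D i j * c.
  by rewrite -mulr_suml sum_prob mul1r.
rewrite (mean_cst (- (gmax / gmin))) (mean_cst ((1 + gmax) / gmin)) /scaled_level.
apply/andP; split; apply: ler_sum => j _; rewrite -[_ / step D j]mulrA;
  rewrite ler_wpM2l ?prob_ge0//; by have /andP[] := level_step_bound i j.
Qed.

End Drift.

(** * A strong law for orthogonal bounded variables *)

(** Between consecutive squares the partial sums move by at most a constant times the square root of
    n, which is negligible after division by n. *)
Lemma cesaro_squares (R : realType) (z : nat -> R) (c : R) :
  (forall i, `|z i| <= c) ->
  (fun n => (n.+1 ^ 2)%:R^-1 * \sum_(i < n.+1 ^ 2) z i) @ \oo --> (0 : R) ->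
  (fun n => n%:R^-1 * \sum_(i < n) z i) @ \oo --> (0 : R).
Proof.
move=> zc sq0.
have c0 : 0 <= c := le_trans (normr_ge0 _) (zc 0%N).
have inv0 : (fun m => 2 * c * m.+1%:R^-1) @ \oo --> (0 : R).
  by rewrite -[X in _ --> X](mulr0 (2 * c)); apply: cvgMr; exact: cvg_harmonic.
apply/cvgrPdist_lt => e e0; have e2 : 0 < e / 2 by rewrite divr_gt0.
have [M1 _ HM1] := (cvgrPdist_lt _ _).1 sq0 _ e2.
have [M2 _ HM2] := (cvgrPdist_lt _ _).1 inv0 _ e2.
exists ((maxn M1 M2).+1 ^ 2)%N => // n /= nM.
(* Take the largest m with (m + 1)^2 <= n. The choice of the threshold for n forces m to be at least
   [M1] and [M2]. *)
have exm : exists m, (m.+1 ^ 2 <= n)%N by exists (maxn M1 M2).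
have bm m : (m.+1 ^ 2 <= n)%N -> (m <= n)%N.
  by apply: leq_trans; rewrite (leq_trans (leqnSn m))// -mulnn leq_pmulr.
case: (ex_maxnP exm bm) => m mn mmax.
have mM : (maxn M1 M2 <= m)%N by exact: mmax.
have {mmax} nm : (n < m.+2 ^ 2)%N.
  by rewrite ltnNge; apply/negP => /mmax; rewrite ltnn.
have /= := HM1 m (leq_trans (leq_maxl _ _) mM).
have /= := HM2 m (leq_trans (leq_maxr _ _) mM).
rewrite !sub0r !normrN => h2 h1.
have q0 : 0 < (m.+1 ^ 2)%:R :> R by rewrite ltr0n expn_gt0.
have n0 : 0 < n%:R :> R by rewrite (lt_le_trans q0)// ler_nat.
set S := \sum_(i < m.+1 ^ 2) z i in h1.
(* Since n < (m + 2)^2, at most 2 (m + 1) terms lie between the square and n. *)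
have SnE : `|\sum_(i < n) z i - S| <= c * (2 * m.+1%:R).
  rewrite /S -!(big_mkord xpredT z) (big_cat_nat _ mn)//= addrAC subrr add0r.
  rewrite (le_trans (ler_norm_sum _ _ _))//.
  rewrite (le_trans (ler_sum_nat (fun i _ => zc i)))// sumr_const_nat.
  rewrite -(mulr_natr c) ler_wpM2l// -natrM ler_nat leq_subLR.
  by rewrite -ltnS (leq_trans nm)// -!mulnn; lia.
rewrite normrM gtr0_norm ?invr_gt0// mulrC ltr_pdivrMr//.
rewrite -(subrK S (\sum_(i < n) z i)) (le_lt_trans (ler_normD _ _))//.
have {}h1 : `|S| < e / 2 * n%:R.
  move: h1; rewrite normrM gtr0_norm ?invr_gt0// mulrC ltr_pdivrMr// => h1.
  by rewrite (lt_le_trans h1)// ler_pM2l// ler_nat.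
have {}h2 : c * (2 * m.+1%:R) < e / 2 * n%:R.
  apply: (@lt_le_trans _ _ (e / 2 * (m.+1 ^ 2)%:R)); last by rewrite ler_pM2l// ler_nat.
  move: h2; rewrite ger0_norm ?mulr_ge0// ltr_pdivrMr// => h2.
  by rewrite natrX expr2 !mulrA (mulrC c) ltr_pM2r.
by rewrite [e in e * _]splitr mulrDl ltrD// (le_lt_trans SnE).
Qed.

(** Telescoping, from 1 / m^2 <= 2 (1 / m - 1 / (m + 1)) for m >= 1. *)
Lemma sum_inv_squares (R : realType) n :
  \sum_(i < n) (i.+1%:R ^+ 2)^-1 <= 2 * (1 - n.+1%:R^-1) :> R.
Proof.
elim: n => [|n ih]; first by rewrite big_ord0 invr1 subrr mulr0.
rewrite big_ord_recr/= (le_trans (lerD ih (lexx _)))//.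
have -> : n.+2%:R = n.+1%:R + 1 :> R by rewrite natr1.
have x1 : 1 <= n.+1%:R :> R by rewrite ler1n.
move: (n.+1%:R : R) x1 => x x1; have x0 : 0 < x by lra.
rewrite -subr_ge0.
have -> : 2 * (1 - (x + 1)^-1) - (2 * (1 - x^-1) + (x ^+ 2)^-1) =
   (x - 1) / (x ^+ 2 * (x + 1)) by field; rewrite !gt_eqF//; lra.
by rewrite divr_ge0 ?mulr_ge0 ?sqr_ge0//; lra.
Qed.

Section OrthogonalSLLN.
Context d (T : measurableType d) (R : realType) (P : probability T R).

Lemma bounded_integrable (f : T -> R) (c : R) :
  measurable_fun setT f -> (forall w, `|f w| <= c) ->
  P.-integrable setT (EFin \o f).
Proof.
move=> mf fc; apply: measurable_bounded_integrable => //.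
  by rewrite (le_lt_trans (probability_le1 P measurableT))// ltry.
exists c; split; first exact: num_real.
by move=> M cM w _ /=; rewrite (le_trans (fc w))// ltW.
Qed.

Variables (Z : nat -> T -> R) (c : R).
Hypothesis mZ : forall i, measurable_fun setT (Z i).
Hypothesis Zc : forall i w, `|Z i w| <= c.
Hypothesis Z_orth : forall i m, (i < m)%N -> \int[P]_w (Z i w * Z m w) = 0.

Let c_ge0 : 0 <= c := le_trans (normr_ge0 _) (Zc 0%N point).

Let S n w := \sum_(i < n) Z i w.

Let mS n : measurable_fun setT (S n).
Proof. exact: measurable_sum. Qed.

Let S_bound n w : `|S n w| <= n%:R * c.
Proof.
rewrite (le_trans (ler_norm_sum _ _ _))//.
rewrite (le_trans (ler_sum _ (fun (i : 'I_n) _ => Zc i w)))//.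
by rewrite sumr_const card_ord mulr_natl.
Qed.

Let iM (f g : T -> R) (a b : R) :
  measurable_fun setT f -> measurable_fun setT g ->
  (forall w, `|f w| <= a) -> (forall w, `|g w| <= b) ->
  P.-integrable setT (EFin \o (fun w => f w * g w)).
Proof.
move=> mf mg fa gb; apply: (@bounded_integrable _ (a * b)).
  exact: measurable_funM.
by move=> w; rewrite normrM ler_pM.
Qed.

Let iD (f g : T -> R) : P.-integrable setT (EFin \o f) ->
  P.-integrable setT (EFin \o g) ->
  P.-integrable setT (EFin \o (fun w => f w + g w)).
Proof. by move=> f_int g_int; exact: (integrableD measurableT f_int g_int). Qed.

Let S_orth n m : (n <= m)%N -> \int[P]_w (S n w * Z m w) = 0.
Proof.
elim: n => [|n ih] nm.
  under eq_Rintegral do rewrite /S big_ord0 mul0r.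
  by rewrite Rintegral_cst// mul0r.
under eq_Rintegral do rewrite /S big_ord_recr/= mulrDl.
rewrite RintegralD//; last 2 first.
  exact: (iM (mS n) (mZ m) (S_bound n) (Zc m)).
  exact: (iM (mZ n) (mZ m) (Zc n) (Zc m)).
by rewrite Z_orth// addr0 ih// ltnW.
Qed.

(** Expanding the square of S_n + Z_n, the cross terms integrate to 0 by orthogonality, so each time
    adds at most c^2. *)
Lemma second_moment_sum n : \int[P]_w (S n w * S n w) <= n%:R * c ^+ 2.
Proof.
elim: n => [|n ih].
  under eq_Rintegral do rewrite /S big_ord0 mul0r.
  by rewrite Rintegral_cst// !mul0r.
have iSS := iM (mS n) (mS n) (S_bound n) (S_bound n).
have iSZ := iM (mS n) (mZ n) (S_bound n) (Zc n).
have iZZ := iM (mZ n) (mZ n) (Zc n) (Zc n).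
(* The double product is kept as two copies of S_n Z_n, each removed by [S_orth]. *)
have -> : \int[P]_w (S n.+1 w * S n.+1 w) = \int[P]_w (S n w * S n w) +
    \int[P]_w (S n w * Z n w + (S n w * Z n w + Z n w * Z n w)).
  rewrite -RintegralD//; last first.
    exact: iD iSZ (iD iSZ iZZ).
  by apply: eq_Rintegral => w _; rewrite /S big_ord_recr/=; ring.
rewrite RintegralD//; last exact: iD iSZ iZZ.
rewrite RintegralD// S_orth// !add0r -natr1 mulrDl mul1r lerD//.
have -> : c ^+ 2 = \int[P]_w (cst (c ^+ 2) w).
  rewrite Rintegral_cst// [fine _](_ : _ = 1) ?mulr1//.
  exact: (congr1 fine (probability_setT P)).
apply: le_Rintegral => //.
  by apply: (@bounded_integrable _ (c ^+ 2)) => // w; rewrite /= ger0_norm// sqr_ge0.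
by move=> w _ /=; rewrite -expr2 -[leLHS]ger0_norm ?sqr_ge0// normrX lerXn2r ?nnegrE.
Qed.

(** Squared averages along the squares: their second moment bound c^2 / (n + 1)^2 is summable,
    whereas the bound c^2 / n along all n is not. *)
Let f n w := ((n.+1 ^ 2)%:R^-1 * S (n.+1 ^ 2) w) ^+ 2.

Let mf n : measurable_fun setT (f n).
Proof. by apply: measurable_funX; apply: measurable_funM. Qed.

Let int_f n : (\int[P]_w (f n w)%:E <= (c ^+ 2 * (n.+1%:R ^+ 2)^-1)%:E)%E.
Proof.
set q := (n.+1 ^ 2)%N.
have iSS := iM (mS q) (mS q) (S_bound q) (S_bound q).
have q0 : (q%:R : R) != 0 by rewrite pnatr_eq0 expn_eq0.
have i_f : P.-integrable setT (EFin \o f n).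
  apply: (@bounded_integrable _ (c ^+ 2)) => // w.
  rewrite /f -/q normrX lerXn2r ?nnegrE// normrM ger0_norm ?invr_ge0//.
  by rewrite ler_pdivrMl ?lt0r ?q0//=.
rewrite -(fineK (integrable_fin_num measurableT i_f)) lee_fin.
rewrite -/(Rintegral P setT (f n)).
have -> : \int[P]_w (f n w) = \int[P]_w (q%:R^-1 ^+ 2 * (S q w * S q w)).
  by apply: eq_Rintegral => w _; rewrite /f -/q exprMn expr2.
rewrite RintegralZl// (le_trans (ler_wpM2l (sqr_ge0 _) (second_moment_sum q)))//.
rewrite le_eqVlt; apply/orP; left; apply/eqP.
by rewrite -natrX -/q; field.
Qed.

(** The series of the [f n] has integral at most 2 c^2, hence is finite almost everywhere. Its
    general term then tends to 0, which gives convergence along the squares, and [cesaro_squares]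
    fills the gaps. *)
Lemma orthogonal_slln : {ae P, forall w,
  (fun n => n%:R^-1 * \sum_(i < n) Z i w) @ \oo --> (0 : R)}.
Proof.
have f0 n w : 0 <= f n w := sqr_ge0 _.
pose F w := (\sum_(n <oo) (f n w)%:E)%E.
have mF : measurable_fun setT F.
  apply: ge0_emeasurable_sum => [n w _ _|n _]; first by rewrite lee_fin.
  exact/measurable_EFinP.
have F0 w : (0 <= F w)%E by apply: nneseries_ge0 => n *; rewrite lee_fin.
have iF : P.-integrable setT F.
  apply/integrableP; split=> //.
  under eq_integral do rewrite gee0_abs//.
  rewrite integral_nneseries//; last 2 first.
    by move=> n; exact/measurable_EFinP.
    by move=> n w _; rewrite lee_fin.
  have int0 n : (0 <= \int[P]_w (f n w)%:E)%E.
    by apply: integral_ge0 => w _; rewrite lee_fin.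
  apply: (@le_lt_trans _ _ (c ^+ 2 * 2)%:E); last exact: ltry.
  apply: lime_le; first exact: is_cvg_nneseries.
  apply: nearW => n; rewrite big_mkord.
  rewrite (le_trans (lee_sum _ (fun (i : 'I_n) _ => int_f i)))//.
  rewrite sumEFin lee_fin -mulr_sumr ler_wpM2l ?sqr_ge0//.
  rewrite (le_trans (sum_inv_squares R n))// ler_piMr//.
have := integrable_ae measurableT iF; apply: filterS => w /(_ Logic.I) Fw.
apply: (@cesaro_squares _ (fun i => Z i w) c) => //.
have cv_f : (fun n => f n w) @ \oo --> (0 : R).
  apply: cvg_series_cvg_0; apply: nondecreasing_is_cvgn.
    by apply/nondecreasing_series => n _ _.
  exists (fine (F w)) => _ [n _ <-].
  rewrite -lee_fin fineK// /series/= -sumEFin.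
  by apply: nneseries_lim_ge => i _; rewrite lee_fin.
apply/cvgrPdist_lt => e e0.
have [M _ fM] := (cvgrPdist_lt _ _).1 cv_f _ (exprn_gt0 2 e0).
exists M => // n Mn; have := fM n Mn; rewrite /= !sub0r !normrN normrX => h.
by rewrite -(ltr_pXn2r (n:=2))// nnegrE ?normr_ge0// ltW.
Qed.

End OrthogonalSLLN.

(** * Conditional probabilities as densities *)

Section IntegralDensity.
Import HBNNSimple.

(** The hypothesis on [h] is the case where [f] is an indicator. Linearity extends it to simple
    functions, and monotone convergence to nonnegative measurable functions. *)
Lemma ge0_integral_density d d' (T : measurableType d) (T' : measurableType d')
    (R : realType) (P : {measure set T -> \bar R}) (phi : T -> T')
    (E : set T) (h : T -> R) (f : T' -> R) :
  measurable_fun setT phi -> measurable E -> measurable_fun setT h ->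
  (forall w, 0 <= h w) ->
  (forall A, measurable A ->
    P (phi @^-1` A `&` E) = \int[P]_(w in phi @^-1` A) (h w)%:E)%E ->
  measurable_fun setT f -> (forall x, 0 <= f x) ->
  (\int[P]_w (f (phi w) * \1_E w)%:E = \int[P]_w (f (phi w) * h w)%:E)%E.
Proof.
move=> mphi mE mh h0 PE mf f0.
have mEf : measurable_fun setT (EFin \o f) by exact/measurable_EFinP.
pose g := nnsfun_approx measurableT mEf.
have mgphi n : measurable_fun setT (g n \o phi) by exact: measurableT_comp.
(* Stated for a general weight [u], to serve both for the indicator of [E] and for [h]; likewise
   [simple] below. *)
have approx (u : T -> R) : measurable_fun setT u -> (forall w, 0 <= u w) ->
    (\int[P]_w (f (phi w) * u w)%:E =
      limn (fun n => \int[P]_w (g n (phi w) * u w)%:E))%E.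
  move=> mu u0; rewrite -monotone_convergence//=.
  - apply: eq_integral => w _; apply/esym/cvg_lim => //.
    under eq_fun do rewrite EFinM.
    rewrite EFinM; apply: cvgeZr => //.
    by apply: (@cvg_nnsfun_approx _ _ _ _ measurableT _ mEf) => // x _; rewrite lee_fin.
  - by move=> n; apply/measurable_EFinP; exact: (measurable_funM (mgphi n) mu).
  - by move=> n w _; rewrite lee_fin mulr_ge0.
  - move=> w _ a b ab; rewrite lee_fin ler_wpM2r//.
    exact/lefP/nd_nnsfun_approx.
rewrite !approx//; congr (limn _); apply/funext => n.
have simple (u : T -> R) : measurable_fun setT u -> (forall w, 0 <= u w) ->
    (\int[P]_w (g n (phi w) * u w)%:E =
     \sum_(r \in range (g n))
       r%:E * \int[P]_(w in phi @^-1` (g n @^-1` [set r])) (u w)%:E)%E.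
  move=> mu u0.
  have mA r : measurable (phi @^-1` (g n @^-1` [set r])).
    by rewrite -[X in measurable X]setTI; apply: mphi.
  have r0 r : r \in range (g n) -> 0 <= r by rewrite inE => -[x _ <-].
  have mI r : measurable_fun setT (fun w => \1_(g n @^-1` [set r]) (phi w) : R).
    by apply: measurableT_comp => //; exact: measurable_indic.
  transitivity (\int[P]_w (\sum_(r \in range (g n))
      (r * \1_(g n @^-1` [set r]) (phi w))%:E * (u w)%:E))%E.
    apply: eq_integral => w _.
    rewrite EFinM [in LHS]fimfunE -fsumEFin// ge0_mule_fsuml// => r.
    exact: nnfun_muleindic_ge0.
  rewrite ge0_integral_fsum//; last 2 first.
    move=> r; apply: emeasurable_funM; last exact/measurable_EFinP.
    by apply/measurable_EFinP; exact: measurable_funM.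
    by move=> r w _; rewrite mule_ge0 ?nnfun_muleindic_ge0 ?lee_fin.
  apply: eq_fsbigr => r rg.
  under eq_integral do rewrite EFinM -muleA.
  rewrite ge0_integralZl//; last 3 first.
    by apply: emeasurable_funM; exact/measurable_EFinP.
    by move=> w _; rewrite mule_ge0 ?lee_fin.
    by rewrite lee_fin r0.
  congr (_ * _)%E; rewrite [RHS]integral_mkcond; apply: eq_integral => w _.
  rewrite patchE indicE; have [h1|h1] := boolP (w \in _).
    by rewrite (_ : phi w \in _ = true) ?mul1e//; apply/mem_set; exact: set_mem h1.
  rewrite (_ : phi w \in _ = false) ?mul0e//.
  by apply: contraNF h1 => h1; apply/mem_set; exact: set_mem h1.
rewrite !simple//; apply: eq_fsbigr => r _; congr (_ * _)%E.
have mA : measurable (phi @^-1` (g n @^-1` [set r])).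
  by rewrite -[X in measurable X]setTI; apply: mphi.
by rewrite integral_indic// setIC PE.
Qed.

End IntegralDensity.

(** * Measurability in the data and random selection *)

(** Given the data, [E i] and [E m] are independent with probabilities q_i and q_m. The centred
    indicators are therefore conditionally orthogonal, and remain so after multiplication by the
    data functions [v]. *)
Lemma conditional_slln d d' (T : measurableType d) (T' : measurableType d')
    (R : realType) (P : probability T R) (phi : T -> T')
    (E : nat -> set T) (v q : nat -> T' -> R) :
  measurable_fun setT phi -> (forall i, measurable (E i)) ->
  (forall i, measurable_fun setT (v i)) ->
  (forall i x, 0 <= v i x <= 1) ->
  (forall i, measurable_fun setT (q i)) ->
  (forall i x, 0 <= q i x <= 1) ->
  (forall i A, measurable A ->
    P (phi @^-1` A `&` E i) = \int[P]_(w in phi @^-1` A) (q i (phi w))%:E)%E ->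
  (forall i m A, (i < m)%N -> measurable A ->
    P (phi @^-1` A `&` (E i `&` E m)) =
    \int[P]_(w in phi @^-1` A) (q i (phi w) * q m (phi w))%:E)%E ->
  {ae P, forall w,
    (fun n => n%:R^-1 *
      \sum_(i < n) (v i (phi w) * (\1_(E i) w - q i (phi w)))) @ \oo
    --> (0 : R)}.
Proof.
move=> mphi mE mv v01 mq q01 PE PEE.
have m_phi (f : T' -> R) : measurable_fun setT f ->
  measurable_fun setT (fun w => f (phi w)) by move=> mf; exact: measurableT_comp.
have mI i : measurable_fun setT (\1_(E i) : T -> R) by exact: measurable_indic.
have I01 i w : 0 <= (\1_(E i) w : R) <= 1.
  by rewrite indicE; case: (_ \in _); rewrite /= ?lexx ?ler01.
apply: (@orthogonal_slln _ _ _ _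
    (fun i w => v i (phi w) * (\1_(E i) w - q i (phi w))) 1).
- by move=> i; apply: measurable_funM; [exact: m_phi|apply: measurable_funB;
    [exact: mI|exact: m_phi]].
- move=> i w; rewrite normrM; have /andP[? ?] := v01 i (phi w).
  have /andP[? ?] := q01 i (phi w); have /andP[? ?] := I01 i w.
  rewrite -[leRHS]mul1r ler_pM//; first by rewrite ger0_norm.
  by rewrite ler_norml; apply/andP; split; lra.
move=> i m im.
pose f0 x := v i x * v m x.
have f0_01 x : 0 <= f0 x <= 1.
  have /andP[? ?] := v01 i x; have /andP[? ?] := v01 m x.
  by rewrite mulr_ge0//= mulr_ile1.
have mf0 : measurable_fun setT f0 by exact: measurable_funM.
have prod01 (f g : T -> R) : (forall w, 0 <= f w <= 1) -> (forall w, 0 <= g w <= 1) ->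
    forall w, 0 <= f w * g w <= 1.
  move=> f01 g01 w; have /andP[? ?] := f01 w; have /andP[? ?] := g01 w.
  by rewrite mulr_ge0//= mulr_ile1.
have intg (f g : T -> R) : measurable_fun setT f -> measurable_fun setT g ->
    (forall w, 0 <= f w <= 1) -> (forall w, 0 <= g w <= 1) ->
    P.-integrable setT (EFin \o (fun w => f w * g w)).
  move=> mf mg f01 g01; apply: (@bounded_integrable _ _ _ _ _ 1).
    exact: measurable_funM.
  by move=> w; have /andP[? ?] := prod01 _ _ f01 g01 w; rewrite ger0_norm.
(* The two cross terms of the product: [fm] is paired with the indicator of [E i], and [fi] with
   that of [E m]. *)
pose fi x := f0 x * q i x; pose fm x := f0 x * q m x.
have dens (E' : set T) (h : T -> R) (f : T' -> R) : measurable E' ->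
    measurable_fun setT h -> (forall w, 0 <= h w) ->
    (forall A, measurable A ->
      P (phi @^-1` A `&` E') = \int[P]_(w in phi @^-1` A) (h w)%:E)%E ->
    measurable_fun setT f -> (forall x, 0 <= f x) ->
    \int[P]_w (f (phi w) * \1_E' w) = \int[P]_w (f (phi w) * h w).
  move=> mE' mh h0 PE' mf f_ge0; rewrite /Rintegral.
  by congr fine; exact: (ge0_integral_density mphi).
have fi01 x : 0 <= fi x <= 1.
  have /andP[? ?] := f0_01 x; have /andP[? ?] := q01 i x.
  by rewrite mulr_ge0//= mulr_ile1.
have fm01 x : 0 <= fm x <= 1.
  have /andP[? ?] := f0_01 x; have /andP[? ?] := q01 m x.
  by rewrite mulr_ge0//= mulr_ile1.
have mfi : measurable_fun setT fi by exact: measurable_funM.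
have mfm : measurable_fun setT fm by exact: measurable_funM.
have mEE : measurable (E i `&` E m) by exact: measurableI.
have mqq : measurable_fun setT (fun w => q i (phi w) * q m (phi w)).
  by apply: measurable_funM; exact: m_phi.
have qq01 w : 0 <= q i (phi w) * q m (phi w) <= 1.
  exact: (prod01 (fun w => q i (phi w)) (fun w => q m (phi w))).
have e_im := dens _ _ f0 mEE mqq (fun w => (andP (qq01 w)).1)
  (fun A => PEE i m A im) mf0 (fun x => (andP (f0_01 x)).1).
have e_i := dens _ _ fm (mE i) (m_phi _ (mq i)) (fun w => (andP (q01 i (phi w))).1)
  (PE i) mfm (fun x => (andP (fm01 x)).1).
have e_m := dens _ _ fi (mE m) (m_phi _ (mq m)) (fun w => (andP (q01 m (phi w))).1)
  (PE m) mfi (fun x => (andP (fi01 x)).1).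
set I := \int[P]_w (f0 (phi w) * (q i (phi w) * q m (phi w))).
have i_im : P.-integrable setT (EFin \o (fun w => f0 (phi w) * \1_(E i `&` E m) w)).
  apply: (intg (fun w => f0 (phi w)) (\1_(E i `&` E m))) => //; [exact: m_phi|].
  by move=> w; rewrite indicE; case: (_ \in _); rewrite /= ?lexx ?ler01.
have i_i : P.-integrable setT (EFin \o (fun w => fm (phi w) * \1_(E i) w)).
  by apply: (intg (fun w => fm (phi w)) (\1_(E i))) => //; exact: m_phi.
have i_m : P.-integrable setT (EFin \o (fun w => fi (phi w) * \1_(E m) w)).
  by apply: (intg (fun w => fi (phi w)) (\1_(E m))) => //; exact: m_phi.
have i_q : P.-integrable setT
    (EFin \o (fun w => f0 (phi w) * (q i (phi w) * q m (phi w)))).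
  by apply: (intg (fun w => f0 (phi w))) => //; exact: m_phi.
have iB (f g : T -> R) : P.-integrable setT (EFin \o f) ->
    P.-integrable setT (EFin \o g) ->
    P.-integrable setT (EFin \o (fun w => f w - g w)).
  by move=> jf jg; exact: (integrableB measurableT jf jg).
(* The product of the centred terms expands into four integrals. Each equals [I], and the signs
   cancel. *)
transitivity (\int[P]_w ((f0 (phi w) * \1_(E i `&` E m) w - fm (phi w) * \1_(E i) w)
   - (fi (phi w) * \1_(E m) w - f0 (phi w) * (q i (phi w) * q m (phi w))))).
  apply: eq_Rintegral => w _; rewrite indicI /fi /fm /f0 /=; ring.
rewrite RintegralB//; [|exact: iB|exact: iB].
rewrite !RintegralB// e_im e_i e_m.
have -> : \int[P]_w (fm (phi w) * q i (phi w)) = I.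
  by apply: eq_Rintegral => w _; rewrite /fm; ring.
have -> : \int[P]_w (fi (phi w) * q m (phi w)) = I.
  by apply: eq_Rintegral => w _; rewrite /fi; ring.
by rewrite !subrr.
Qed.

(** * Measurability of levels, weights and probabilities *)

Section Measurability.
Context d (T : measurableType d) (R : realType) (k : nat).
Variables (tgt : R) (stp : 'I_k.+1 -> R) (lr mix : nat -> R).
Variables (C : T -> nat -> R -> set R) (y : T -> nat -> R).

Hypothesis C_measurable : forall i a, measurable [set w | C w i a (y w i)].
Hypothesis C_antitone :
  forall w i a b, a <= b -> C w i b (y w i) -> C w i a (y w i).

Let D w := Dtaci tgt stp lr mix (C w) (y w).

(** The preimage splits over the countably many values of [f], and on each piece the parameter is
    frozen. *)
Lemma measurable_fun_countable_param (f : T -> R) (a : nat -> R)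
    (G : R -> T -> R) :
  measurable_fun setT f -> (forall w, exists m, f w = a m) ->
  (forall r, measurable_fun setT (G r)) ->
  measurable_fun setT (fun w => G (f w) w).
Proof.
move=> mf fa mG _ B mB; rewrite setTI.
have -> : (fun w => G (f w) w) @^-1` B =
    \bigcup_m (f @^-1` [set a m] `&` G (a m) @^-1` B).
  apply/seteqP; split => [w Bw|w [m _ [/= fE Gw]]] /=; last by rewrite fE.
  by have [m fE] := fa w; exists m => //; split => //=; rewrite -fE.
apply: bigcupT_measurable => m; apply: measurableI.
  by rewrite -[X in measurable X]setTI; apply: mf.
by rewrite -[X in measurable X]setTI; apply: mG.
Qed.

Lemma measurable_miss i a : measurable_fun setT (fun w => miss (D w) i a).
Proof.
rewrite [X in measurable_fun _ X](_ : _ = \1_(~` [set w | C w i a (y w i)])).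
  by apply: measurable_indic; exact: measurableC.
by apply/funext => w; rewrite /miss !indicE.
Qed.

(* Measurability of the prediction set is only available at a fixed level, and
   the levels take countably many values. *)
Lemma level_lattice w i j :
  exists m : nat, level (D w) i j = tgt + stp j * (i%:R * tgt - m%:R).
Proof.
elim: i => [|i [m ih]] /=; first by exists 0%N; rewrite mul0r subrr mulr0 addr0.
have [M missE] : exists M : nat, miss (D w) i (level (D w) i j) = M%:R.
  by rewrite /miss indicE; case: (_ \in _); [exists 1%N|exists 0%N].
by exists (m + M)%N; rewrite missE ih natrD -natr1; ring.
Qed.

Lemma measurable_miss_level i j :
  measurable_fun setT (fun w => level (D w) i j) ->
  measurable_fun setT (fun w => miss (D w) i (level (D w) i j)).
Proof.
move=> ml; apply: (@measurable_fun_countable_param _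
  (fun m : nat => tgt + stp j * (i%:R * tgt - m%:R)) (fun r w => miss (D w) i r)) => //.
  by move=> w; exact: level_lattice.
by move=> r; exact: measurable_miss.
Qed.

Lemma measurable_level i j : measurable_fun setT (fun w => level (D w) i j).
Proof.
elim: i => [|i ih] /=; first exact: measurable_cst.
apply: measurable_funD => //; apply: measurable_funM => //.
by apply: measurable_funB => //; exact: measurable_miss_level.
Qed.

Lemma measurable_beta i : measurable_fun setT (fun w => beta (D w) i).
Proof.
apply: (measurability _ (RGenOInfty.measurableE R)) => _ [_ [c ->] <-].
rewrite setTI preimage_itvoy.
pose A w := [set b : R | 0 <= b <= 1 /\ C w i b (y w i)].
have A_ub w : has_ubound (A w) by exists 1 => b [/andP[]].
(* For negative c the event is everything, since [beta] is nonnegative even when the supremum is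
   over the empty set. *)
have [c0|c0] := ltP c 0.
  rewrite [X in measurable X](_ : _ = setT)//; apply/seteqP; split => // w _ /=.
  rewrite (lt_le_trans c0)// /beta -/(A w).
  have [->|/set0P[b Ab]] := eqVneq (A w) set0; first by rewrite sup0.
  have := Ab => -[/andP[b0 _] _]; rewrite (le_trans b0)//.
  exact: ub_le_sup.
(* A level above c at which the response is covered can be lowered to a rational still above c,
   because the sets shrink as the level grows. The union becomes countable. *)
have -> : [set w | c < beta (D w) i] = \bigcup_(r : rat)
    [set w | (c < (ratr r : R) <= 1) /\ C w i (ratr r) (y w i)].
  apply/seteqP; split => [w /=|w [r _ [/andP[cr r1] Cr]]] /=.
    rewrite /beta -/(A w) => c_sup.
    have A0 : A w !=set0.
      apply/set0P; move: c_sup; apply: contraTneq => ->;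
      by rewrite sup0 -leNgt.
    have [b [/andP[b0 b1] Cb] cb] := sup_gt A0 c_sup.
    have [r /[!in_itv]/= /andP[cr rb]] := rat_in_itvoo cb.
    exists r => //; split; first by rewrite cr (le_trans (ltW rb)).
    exact: C_antitone (ltW rb) Cb.
  rewrite (lt_le_trans cr)// /beta -/(A w); apply: ub_le_sup => //.
  by split => //; rewrite r1 (le_trans c0)// ltW.
apply: bigcupT_measurable_rat => r.
have [h|h] := boolP (c < (ratr r : R) <= 1).
  rewrite [X in measurable X](_ : _ = [set w | C w i (ratr r) (y w i)])//.
  by apply/seteqP; split => w /= => [[]|].
rewrite [X in measurable X](_ : _ = set0)//.
by apply/seteqP; split => w /= => [[]|].
Qed.

Lemma measurable_weight i j : measurable_fun setT (fun w => weight (D w) i j).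
Proof.
elim: i j => [|i ih] j; first exact: measurable_cst.
pose wt l w := weight (D w) i l *
  expR (- lr i * pinball (D w) (beta (D w) i) (level (D w) i l)).
have mt l : measurable_fun setT (wt l).
  apply: measurable_funM => //.
  apply: (measurableT_comp (@measurable_expR R)); apply: measurable_funM => //.
  have mba : measurable_fun setT (fun w => beta (D w) i - level (D w) i l).
    by apply: measurable_funB; [exact: measurable_beta|exact: measurable_level].
  rewrite /pinball /=; apply: measurable_funB; first exact: measurable_funM.
  by apply: measurable_minr.
change (measurable_fun setT (fun w =>
  (1 - mix i) * wt j w + mix i / k.+1%:R * \sum_l wt l w)).
apply: measurable_funD; first exact: measurable_funM.
by apply: measurable_funM => //; exact: measurable_sum.
Qed.

Lemma measurable_prob i j :
  (forall w, 0 < \sum_l weight (D w) i l) ->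
  measurable_fun setT (fun w => prob (D w) i j).
Proof.
move=> W0; apply: measurable_funM; first exact: measurable_weight.
(* On positive numbers the inverse is exp(-ln), a composition of measurable functions. *)
rewrite [X in measurable_fun _ X](_ : _ =
    (fun w => expR (- ln (\sum_l weight (D w) i l)))).
  apply: (measurableT_comp (@measurable_expR R)); apply: measurable_funN.
  apply: (measurableT_comp (@measurable_ln R)); apply: measurable_sum => l.
  exact: measurable_weight.
by apply/funext => w; rewrite expRN lnK ?posrE.
Qed.

End Measurability.

(** * Marginals of the joint law of the selections *)

Section Selection.
Context d (T : measurableType d) (R : realType) (P : probability T R) (k : nat).
Variables (J : bool -> nat -> T -> 'I_k.+1) (p : bool -> nat -> 'I_k.+1 -> T -> R).
Variables (A : set T) (n : nat).

Hypothesis mA : measurable A.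
Hypothesis mJ : forall t i j, measurable [set w | J t i w = j].
Hypothesis mp : forall t i j, measurable_fun setT (p t i j).
Hypothesis p_ge0 : forall t i j w, 0 <= p t i j w.
Hypothesis p_sum : forall t i w, \sum_j p t i j w = 1.
Hypothesis PJ : forall j : bool -> nat -> 'I_k.+1,
  (P (A `&` [set w | forall t i, (i < n)%N -> J t i w = j t i]) =
   \int[P]_(w in A) (\prod_(i < n) \prod_(t : bool) p t i (j t i) w)%:E)%E.

(* Applied to the probabilities and to the indicators of the selections. *)
Let integral_prod_sum (u : bool -> nat -> 'I_k.+1 -> T -> R)
    (F : bool -> nat -> pred 'I_k.+1) :
  (forall t i j, measurable_fun setT (u t i j)) ->
  (forall t i j w, 0 <= u t i j w) ->
  (\int[P]_(w in A)
    (\prod_(i < n) \prod_(t : bool) \sum_(j | F t i j) u t i j w)%:E =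
   \sum_(c in family (fun x : 'I_n * bool => F x.2 x.1))
     \int[P]_(w in A) (\prod_(x : 'I_n * bool) u x.2 x.1 (c x) w)%:E)%E.
Proof.
move=> mu u0.
rewrite -[RHS]big_filter -ge0_integral_sum//; last 2 first.
- move=> c; apply/measurable_EFinP/measurable_funTS.
  by apply: measurable_prod => x _.
- by move=> c w _; rewrite lee_fin prodr_ge0.
apply: eq_integral => w _; rewrite big_filter sumEFin pair_big/=.
by rewrite (bigA_distr_big_dep (fun x : 'I_n * bool => F x.2 x.1)
  (fun x j => u x.2 x.1 j w)).
Qed.

(** The event is a disjoint union over complete selection patterns [c] allowed by [F].
    Distributivity turns both its indicator and the product of sums of probabilities into sums over
    [c], which [PJ] matches term by term. *)
Lemma selection_in (F : bool -> nat -> pred 'I_k.+1) :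
  (P (A `&` [set w | forall t i, (i < n)%N -> F t i (J t i w)]) =
   \int[P]_(w in A)
     (\prod_(i < n) \prod_(t : bool) \sum_(j | F t i j) p t i j w)%:E)%E.
Proof.
rewrite integral_prod_sum//.
pose u t i j w : R := (J t i w == j)%:R.
have mu t i j : measurable_fun setT (u t i j).
  rewrite (_ : u t i j = \1_[set w | J t i w = j]); first exact: measurable_indic.
  apply/funext => w; rewrite indicE /u; congr (_%:R); congr nat_of_bool.
  apply/idP/idP => [/eqP h|/set_mem/= ->]; first exact: mem_set.
  exact: eqxx.
have u0 t i j w : 0 <= u t i j w by rewrite ler0n.
have prod_indic (c : 'I_n * bool -> pred 'I_k.+1) w :
    \prod_(x : 'I_n * bool) (c x (J x.2 x.1 w))%:R =
    \1_[set w | forall x : 'I_n * bool, c x (J x.2 x.1 w)] w :> R.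
  rewrite indicE; case: (boolP (_ \in _)) => [|/negP h].
    by rewrite inE /= => h; rewrite big1// => x _; rewrite h.
  have [[x Fx]|noex] := pselect (exists x : 'I_n * bool, ~~ c x (J x.2 x.1 w)).
    by rewrite (bigD1 x)//= (negbTE Fx) mul0r.
  exfalso; apply: h; rewrite inE /= => x.
  by apply/negPn/negP => nF; apply: noex; exists x.
have m_event (c : 'I_n * bool -> pred 'I_k.+1) :
    measurable [set w | forall x : 'I_n * bool, c x (J x.2 x.1 w)].
  apply/(@measurable_indicP _ _ R).
  rewrite [X in measurable_fun _ X](_ : _ =
    fun w => \prod_(x : 'I_n * bool) (c x (J x.2 x.1 w))%:R).
    apply: measurable_prod => x _.
    rewrite [X in measurable_fun _ X](_ : _ =
      (fun w => \sum_(j | c x j) u x.2 x.1 j w)); last first.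
      apply/funext => w; rewrite big_mkcond (bigD1 (J x.2 x.1 w))//= big1 => [|j jJ].
        by rewrite addr0 /u eqxx; case: ifP.
      by rewrite /u eq_sym (negbTE jJ) if_same.
    by under eq_fun do rewrite big_mkcond; apply: measurable_sum => j; case: (c x j).
  by apply/funext => w; rewrite -prod_indic.
have int_event (c : 'I_n * bool -> pred 'I_k.+1) :
    (P (A `&` [set w | forall x : 'I_n * bool, c x (J x.2 x.1 w)]) =
     \int[P]_(w in A) (\prod_(x : 'I_n * bool) (c x (J x.2 x.1 w))%:R)%:E)%E.
  by under eq_integral do rewrite prod_indic; rewrite integral_indic// setIC.
have -> : [set w | forall t i, (i < n)%N -> F t i (J t i w)] =
    [set w | forall x : 'I_n * bool, F x.2 x.1 (J x.2 x.1 w)].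
  apply/seteqP; split => w /= h; first by move=> [i t] /=; exact: h.
  by move=> t i ilt; exact: (h (Ordinal ilt, t)).
rewrite (int_event (fun x => F x.2 x.1)).
transitivity (\int[P]_(w in A)
    (\prod_(i < n) \prod_(t : bool) \sum_(j | F t i j) u t i j w)%:E)%E.
  apply: eq_integral => w _; rewrite pair_big/=; congr (_%:E).
  apply: eq_bigr => x _.
  rewrite big_mkcond (bigD1 (J x.2 x.1 w))//= big1 => [|j jJ].
    by rewrite addr0 /u eqxx; case: ifP.
  by rewrite /u eq_sym (negbTE jJ) if_same.
rewrite integral_prod_sum//; apply: eq_bigr => c _.
rewrite -(int_event (fun x => pred1 (c x))).
(* [PJ] expects choices at all times: the finite pattern is extended by [ord0] from time [n] on,
   where the event does not look. *)
pose j t i := if insub i is Some o then c (o, t) else ord0.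
have jE t (o : 'I_n) : j t o = c (o, t) by rewrite /j valK.
rewrite [X in P (A `&` X)](_ : _ = [set w | forall t i, (i < n)%N -> J t i w = j t i]).
  rewrite PJ; apply: eq_integral => w _; rewrite pair_big/=; congr (_%:E).
  by apply: eq_bigr => -[i t] _ /=; rewrite jE.
apply/seteqP; split => w /= h.
  by move=> t i ilt; have /eqP := h (Ordinal ilt, t); rewrite -jE.
by move=> [i t] /=; rewrite -jE; apply/eqP; exact: h.
Qed.

(** Only the coordinates (t, i) and (t, m) are constrained; every other factor sums to 1. *)
Lemma selection_pair t i m j : (i < m)%N -> (m < n)%N ->
  (P (A `&` ([set w | J t i w = j] `&` [set w | J t m w = j])) =
   \int[P]_(w in A) (p t i j w * p t m j w)%:E)%E.
Proof.
move=> im mn; have in_ := ltn_trans im mn.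
pose F t' i' : pred 'I_k.+1 :=
  fun j' => ((t' == t) && ((i' == i) || (i' == m))) ==> (j' == j).
rewrite [X in P (A `&` X)](_ : _ = [set w | forall t i, (i < n)%N -> F t i (J t i w)]).
  rewrite selection_in; apply: eq_integral => w _; congr (_%:E).
  have FE i' : (i' == i) || (i' == m) -> \sum_(j' | F t i' j') p t i' j' w = p t i' j w.
    by move=> h; rewrite /F eqxx h/= big_pred1_eq.
  have F1 t' i' : ~~ ((t' == t) && ((i' == i) || (i' == m))) ->
      \sum_(j' | F t' i' j') p t' i' j' w = 1.
    move=> h; rewrite -[RHS](p_sum t' i' w); apply: eq_bigl => j'.
    by rewrite /F (negbTE h).
  rewrite pair_big/= (bigD1 (Ordinal in_, t))//= (bigD1 (Ordinal mn, t))/=; last first.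
    by rewrite xpair_eqE negb_and -val_eqE/= gtn_eqF.
  rewrite !FE ?eqxx ?orbT// big1 ?mulr1// => -[i' t'] /=.
  rewrite !xpair_eqE -!val_eqE/= => h; apply: F1; move: h.
  by case: (t' == t); rewrite ?andbT ?andbF//= negb_or.
apply/seteqP; split => w /=.
  move=> [Ji Jm] t' i' _; apply/implyP => /andP[/eqP-> /orP[]/eqP->]; exact/eqP.
move=> h; split; apply/eqP.
  by have := h t i in_; rewrite /F !eqxx.
by have := h t m mn; rewrite /F !eqxx orbT.
Qed.

Lemma selection_single t i j : (i < n)%N ->
  (P (A `&` [set w | J t i w = j]) = \int[P]_(w in A) (p t i j w)%:E)%E.
Proof.
move=> in_.
pose F t' i' : pred 'I_k.+1 := fun j' => ((t' == t) && (i' == i)) ==> (j' == j).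
rewrite [X in P (A `&` X)](_ : _ = [set w | forall t i, (i < n)%N -> F t i (J t i w)]).
  rewrite selection_in; apply: eq_integral => w _; congr (_%:E).
  rewrite pair_big/= (bigD1 (Ordinal in_, t))//= /F !eqxx/= big_pred1_eq.
  rewrite big1 ?mulr1// => -[i' t'] /=; rewrite xpair_eqE -val_eqE/= andbC => /negbTE h.
  by rewrite -[RHS](p_sum t' i' w); apply: eq_bigl => j'; rewrite h.
apply/seteqP; split => w /=.
  by move=> Ji t' i' _; apply/implyP => /andP[/eqP-> /eqP->]; exact/eqP.
by move=> h; apply/eqP; have := h t i in_; rewrite /F !eqxx.
Qed.

End Selection.

(** * Two tails *)

Lemma sel_expectD (R : realType) (k : nat) (p q f g : 'I_k.+1 -> R) :
  \sum_j p j = 1 -> \sum_j q j = 1 ->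
  sel_expect p q (fun j l => f j + g l) =
  \sum_j p j * f j + \sum_j q j * g j.
Proof.
move=> p1 q1; rewrite /sel_expect.
transitivity (\sum_j (p j * f j + p j * \sum_l q l * g l)).
  apply: eq_bigr => j _; rewrite -[X in X + _](mulr1 (p j * f j)) -q1 !mulr_sumr.
  by rewrite -big_split/=; apply: eq_bigr => l _; ring.
by rewrite big_split/= -mulr_suml p1 mul1r.
Qed.

(** Cesàro's theorem. The shift is there because [arithmetic_mean] at n averages n + 1 terms. *)
Lemma average_cvg (R : realType) (u : nat -> R) (l : R) :
  u @ \oo --> l ->
  (fun n => n%:R^-1 * \sum_(i < n) u i) @ \oo --> l.
Proof.
move=> /cesaro; rewrite -[X in _ -> X]cvg_shiftS.
rewrite (_ : arithmetic_mean u = fun n => n.+1%:R^-1 * \sum_(i < n.+1) u i)//.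
by apply/funext => n; rewrite /arithmetic_mean seriesEord.
Qed.

Section TwoTails.
Variables (R : realType) (k : nat) (gamma : 'I_k.+1 -> R) (D : bool -> dtaci R k).
Hypothesis stepE : forall t, step (D t) = gamma.
Hypothesis target01 : forall t, 0 < target (D t) < 1.
Hypothesis gamma_gt0 : forall j, 0 < gamma j.
Hypothesis lrate_gt0 : forall t i, 0 < lrate (D t) i.
Hypothesis mixing01 : forall t i, 0 < mixing (D t) i < 1.
Hypothesis miss_lt0 : forall t i a, a < 0 -> miss (D t) i a = 0.
Hypothesis miss_gt1 : forall t i a, 1 < a -> miss (D t) i a = 1.

Let gmin := grid_min gamma.
Let gmax := grid_max gamma.
Let s i := scaled_level (D lower) i + scaled_level (D upper) i.
Let g (x : R) := x * expR (x * (1 + 2 * gmax)).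

(** Adding the two telescoped sums leaves s_0 - s_N plus the drifts. Since s_N lies between - 2 gmax
    / gmin and (2 + 2 gmax) / gmin, the two entries of the maximum bound this difference from above
    and from below. *)
Lemma average_total_miss N : (0 < N)%N ->
  `| N%:R^-1 * \sum_(i < N) (mean_miss (D lower) i + mean_miss (D upper) i)
     - (target (D lower) + target (D upper)) | <=
  Num.max (s 0 + 2 * gmax / gmin) ((2 + 2 * gmax) / gmin - s 0) / N%:R
  + (1 + 2 * gmax) ^+ 2 / gmin *
    (N%:R^-1 * \sum_(i < N) (g (lrate (D lower) i) + g (lrate (D upper) i)))
  + 2 * ((1 + gmax) / gmin) *
    (N%:R^-1 * \sum_(i < N) (mixing (D lower) i + mixing (D upper) i)).
Proof.
move=> N0; have N0' : 0 < N%:R :> R by rewrite ltr0n.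
have st0 t j : 0 < step (D t) j by rewrite stepE.
have drift_t t := sum_mean_miss (target01 t) (st0 t) (lrate_gt0 t) (mixing01 t)
  (@miss_lt0 t) (@miss_gt1 t) N.
have bound_t t i := scaled_level_bound (target01 t) (st0 t) (mixing01 t)
  (@miss_lt0 t) (@miss_gt1 t) i.
have := bound_t lower N; have := bound_t upper N.
rewrite !stepE -/gmin -/gmax => /andP[u0 u1] /andP[l0 l1].
have := drift_t lower; have := drift_t upper.
pose dL := \sum_(i < N) drift (D lower) i.
pose dU := \sum_(i < N) drift (D upper) i.
rewrite -/dL -/dU.
set mU := \sum_(i < N) (mean_miss (D upper) i - _).
set mL := \sum_(i < N) (mean_miss (D lower) i - _).
move=> hU hL.
have -> : N%:R^-1 * \sum_(i < N) (mean_miss (D lower) i + mean_miss (D upper) i)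
     - (target (D lower) + target (D upper)) = N%:R^-1 * (mL + mU).
  rewrite /mL /mU !sumrB !sumr_const !card_ord big_split/=.
  rewrite -!(mulr_natl (target _)); field.
  by rewrite gt_eqF.
(* Quantifying over [B] keeps the maximum opaque while 1 / N is factored out. *)
have -> : forall B, B / N%:R
  + (1 + 2 * gmax) ^+ 2 / gmin *
    (N%:R^-1 * \sum_(i < N) (g (lrate (D lower) i) + g (lrate (D upper) i)))
  + 2 * ((1 + gmax) / gmin) *
    (N%:R^-1 * \sum_(i < N) (mixing (D lower) i + mixing (D upper) i)) =
  N%:R^-1 * (B + (dL + dU)).
  move=> B; rewrite !big_split/=.
  have -> : dL = (1 + 2 * gmax) ^+ 2 / gmin * \sum_(i < N) g (lrate (D lower) i)
      + 2 * ((1 + gmax) / gmin) * \sum_(i < N) mixing (D lower) i.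
    by rewrite !mulr_sumr -big_split; apply: eq_bigr => i _; rewrite /drift stepE.
  have -> : dU = (1 + 2 * gmax) ^+ 2 / gmin * \sum_(i < N) g (lrate (D upper) i)
      + 2 * ((1 + gmax) / gmin) * \sum_(i < N) mixing (D upper) i.
    by rewrite !mulr_sumr -big_split; apply: eq_bigr => i _; rewrite /drift stepE.
  by ring.
rewrite normrM gtr0_norm ?invr_gt0// ler_pM2l ?invr_gt0//.
have tele : mL + mU = (mL - (scaled_level (D lower) 0 - scaled_level (D lower) N))
  + (mU - (scaled_level (D upper) 0 - scaled_level (D upper) N)) + (s 0 - s N).
  by rewrite /s; ring.
rewrite tele addrC (le_trans (ler_normD _ _))// lerD//; last first.
  by rewrite (le_trans (ler_normD _ _))// lerD.
have e1 : 2 * gmax / gmin = gmax / gmin + gmax / gmin by ring.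
have e2 : (2 + 2 * gmax) / gmin = (1 + gmax) / gmin + (1 + gmax) / gmin by ring.
rewrite ler_norml; apply/andP; split.
  rewrite lerNl le_max; apply/orP; right; rewrite e2 /s; lra.
rewrite le_max; apply/orP; left; rewrite e1 /s; lra.
Qed.

Lemma average_total_miss_cvg :
  (forall t, lrate (D t) @ \oo --> (0 : R)) ->
  (forall t, mixing (D t) @ \oo --> (0 : R)) ->
  (fun N => N%:R^-1 *
     \sum_(i < N) (mean_miss (D lower) i + mean_miss (D upper) i)) @ \oo
  --> target (D lower) + target (D upper).
Proof.
move=> lrate0 mixing0.
have g0 t : (fun i => g (lrate (D t) i)) @ \oo --> (0 : R).
  rewrite /g -[X in _ --> X](mul0r (expR (0 * (1 + 2 * gmax)))).
  apply: cvgM => //; apply: continuous_cvg; first exact: continuous_expR.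
  exact: cvgMl.
pose B := Num.max (s 0 + 2 * gmax / gmin) ((2 + 2 * gmax) / gmin - s 0).
have scale0 (K : R) (u : nat -> R) : u @ \oo --> (0 : R) ->
    (fun N => K * u N) @ \oo --> (0 : R).
  by move=> u0; rewrite -[X in _ --> X](mulr0 K); exact: cvgMr.
have inv0 : (fun N : nat => N%:R^-1 : R) @ \oo --> (0 : R).
  by rewrite -cvg_shiftS; exact: cvg_harmonic.
have sum0 (u v : nat -> R) : u @ \oo --> (0 : R) -> v @ \oo --> (0 : R) ->
    (fun i => u i + v i) @ \oo --> (0 : R).
  by move=> u0 v0; rewrite -[X in _ --> X](addr0 0); exact: cvgD.
have rhs0 := sum0 _ _
  (sum0 _ _ (scale0 B _ inv0)
     (scale0 ((1 + 2 * gmax) ^+ 2 / gmin) _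
       (average_cvg (sum0 _ _ (g0 lower) (g0 upper)))))
  (scale0 (2 * ((1 + gmax) / gmin)) _
       (average_cvg (sum0 _ _ (mixing0 lower) (mixing0 upper)))).
apply/cvgrPdist_lt => e e0.
have [M _ rhs_lt] := (cvgrPdist_lt _ _).1 rhs0 _ e0.
(* Starting at [M.+1] makes N positive, as the finite bound requires. *)
exists M.+1 => // N /= MN; rewrite distrC.
apply: le_lt_trans (average_total_miss (leq_trans _ MN)) _ => //.
by have := rhs_lt N (ltnW MN); rewrite /= sub0r normrN; apply: le_lt_trans;
  exact: ler_norm.
Qed.

End TwoTails.


(** * Bound and almost sure limit for the conformal sets *)

Theorem theorem4p3
  (R : realType) (d : measure_display) (T : measurableType d)
  (P : probability T R) (p n0 k : nat)
  (* data: initial sample of size n0, then the online pairs *)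
  (X : nat -> T -> 'rV[R]_p) (Y : nat -> T -> R)
  (HX : forall m c, measurable_fun setT (fun w => X m w ord0 c))
  (HY : forall m, measurable_fun setT (Y m))
  (* rules computing scores and quantile functions from past data *)
  (score : bool -> nat -> seq ('rV[R]_p * R) -> 'rV[R]_p -> R -> R)
  (quant : bool -> nat -> seq ('rV[R]_p * R) -> R -> \bar R)
  (* parameters of the two procedures *)
  (alpha : bool -> R) (gamma : 'I_k.+1 -> R) (eta sigma : bool -> nat -> R)
  (Halpha : forall t, 0 < alpha t < 1)
  (Hgamma : forall j, 0 < gamma j)
  (Heta : forall t i, 0 < eta t i)
  (Hsigma : forall t i, 0 < sigma t i < 1)
  (* index selected at each time, for each tail *)
  (J : bool -> nat -> T -> 'I_k.+1) :
  let S t i w := score t i (past n0 X Y i w) in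
  let Q t i w := quant t i (past n0 X Y i w) in
  let C t w i := conformal_set (S t i w) (Q t i w) (X (n0 + i)%N w) in
  let D t w := Dtaci (alpha t) gamma (eta t) (sigma t) (C t w)
                     (fun i => Y (n0 + i)%N w) in
  (forall t i w x, quasi_convex (S t i w x)) ->
  (forall t i w, {homo Q t i w : a b / a <= b >-> (a <= b)%E}) ->
  (forall t i w a, a < 0 -> Q t i w a = -oo%E) ->
  (forall t i w a, 1 < a -> Q t i w a = +oo%E) ->
  (forall t i w a, closed_ray t (C t w i a)) ->
  (forall t i, data_measurable X Y
     (fun w => S t i w (X (n0 + i)%N w) (Y (n0 + i)%N w))) ->
  (forall t i a, data_measurable X Y (fun w => Q t i w a)) ->
  (* given the data, the selections are independent over times and tails,
     with the DtACI probabilities *)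
  (forall t i j, measurable [set w | J t i w = j]) ->
  (forall (n : nat) (A : set T) (j : bool -> nat -> 'I_k.+1),
     data_sigma X Y A ->
     P (A `&` [set w | forall t i, (i < n)%N -> J t i w = j t i]) =
     (\int[P]_(w in A)
        (\prod_(i < n) \prod_(t : bool) prob (D t w) i (j t i))%:E)%E) ->
  let gmin := grid_min gamma in
  let gmax := grid_max gamma in
  let alpha_tot := alpha lower + alpha upper in
  let err_tot i w :=
    miss (D lower w) i (level (D lower w) i (J lower i w)) +
    miss (D upper w) i (level (D upper w) i (J upper i w)) in
  let E_err_tot i w :=
    sel_expect (prob (D lower w) i) (prob (D upper w) i)
      (fun j l => miss (D lower w) i (level (D lower w) i j) +
                  miss (D upper w) i (level (D upper w) i l)) in
  let alphat_tot i w :=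
    scaled_level (D lower w) i + scaled_level (D upper w) i in
  let B0 w :=
    Num.max (alphat_tot 0%N w + 2 * gmax / gmin)
            ((2 + 2 * gmax) / gmin - alphat_tot 0%N w) in
  let g (x : R) := x * expR (x * (1 + 2 * gmax)) in
  [/\ forall w (N : nat), (0 < N)%N ->
        `| N%:R^-1 * \sum_(i < N) E_err_tot i w - alpha_tot | <=
        B0 w / N%:R
        + (1 + 2 * gmax) ^+ 2 / gmin *
          (N%:R^-1 * \sum_(i < N) (g (eta lower i) + g (eta upper i)))
        + 2 * ((1 + gmax) / gmin) *
          (N%:R^-1 * \sum_(i < N) (sigma lower i + sigma upper i)),
      (forall t, eta t @ \oo --> (0 : R)) ->
      (forall t, sigma t @ \oo --> (0 : R)) ->
      {ae P, forall w,
        (fun N : nat => N%:R^-1 * \sum_(i < N) err_tot i w) @ \oo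
          --> alpha_tot} &
      forall eta0 sigma0 : nat -> R,
        (forall t i, eta t i = eta0 i) ->
        (forall t i, sigma t i = sigma0 i) ->
        forall w (N : nat), (0 < N)%N ->
        `| N%:R^-1 * \sum_(i < N) E_err_tot i w - alpha_tot | <=
        B0 w / N%:R
        + 2 * ((1 + 2 * gmax) ^+ 2 / gmin) *
          (N%:R^-1 * \sum_(i < N) g (eta0 i))
        + 4 * ((1 + gmax) / gmin) * (N%:R^-1 * \sum_(i < N) sigma0 i)].
Proof.
move=> S Q C D _ Q_mono Q_lt0 Q_gt1 _ S_data Q_data mJ PJ.
move=> gmin gmax alpha_tot err_tot E_err_tot alphat_tot B0 g.
(* A negative level evaluates the quantile function above 1, where it is +oo and the set is the
   whole line. A level above 1 evaluates it below 0, where it is -oo and the set is empty. *)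
have miss_lt0 w t i a : a < 0 -> miss (D t w) i a = 0.
  move=> a0; rewrite /miss indicE memNset//= => -[]; rewrite /C /conformal_set /=.
  by rewrite Q_gt1 ?leey//; lra.
have miss_gt1 w t i a : 1 < a -> miss (D t w) i a = 1.
  move=> a1; rewrite /miss indicE mem_set//=.
  by rewrite /C /conformal_set /= Q_lt0 ?leeNy_eq//; lra.
have E_errE i w : E_err_tot i w = mean_miss (D lower w) i + mean_miss (D upper w) i.
  by rewrite /E_err_tot sel_expectD// sum_prob//; exact: Hsigma.
have sum_E w N : \sum_(i < N) E_err_tot i w =
    \sum_(i < N) (mean_miss (D lower w) i + mean_miss (D upper w) i).
  by apply: eq_bigr => i _; exact: E_errE.
have bound w N : (0 < N)%N ->
  `| N%:R^-1 * \sum_(i < N) E_err_tot i w - alpha_tot | <=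
        B0 w / N%:R
        + (1 + 2 * gmax) ^+ 2 / gmin *
          (N%:R^-1 * \sum_(i < N) (g (eta lower i) + g (eta upper i)))
        + 2 * ((1 + gmax) / gmin) *
          (N%:R^-1 * \sum_(i < N) (sigma lower i + sigma upper i)).
  by move=> N0; rewrite sum_E; exact: (average_total_miss (D := D ^~ w) (fun=> erefl)
    Halpha Hgamma Heta Hsigma (miss_lt0 w) (miss_gt1 w) N0).
split=> [//| |eta0 sigma0 etaE sigmaE w N N0]; last first.
  apply: (le_trans (bound w N N0)); rewrite le_eqVlt; apply/orP; left; apply/eqP.
  have -> : \sum_(i < N) (g (eta lower i) + g (eta upper i)) =
      2 * \sum_(i < N) g (eta0 i).
    by rewrite mulr_sumr; apply: eq_bigr => i _; rewrite !etaE; ring.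
  have -> : \sum_(i < N) (sigma lower i + sigma upper i) =
      2 * \sum_(i < N) sigma0 i.
    by rewrite mulr_sumr; apply: eq_bigr => i _; rewrite !sigmaE; ring.
  by ring.
move=> eta_0 sigma_0.
(* [T'] is [T] with the sigma-algebra generated by the data, and [phi] is the identity:
   measurability on [T'] means measurability in the data. *)
pose T' : measurableType _ := g_sigma_algebraType (data_cylinders X Y).
pose phi : T -> T' := id.
have mphi : measurable_fun setT phi.
  move=> _ B mB; rewrite setTI.
  suff : data_sigma X Y `<=` @measurable d T by apply.
  apply: smallest_sub; first exact: sigma_algebra_measurable.
  move=> _ [m _ [[V mV <-]|[c _ [V mV <-]]]]; first exact: HY.
  exact: HX.
have m_sets t i a : measurable ([set w | C t w i a (Y (n0 + i)%N w)] : set T').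
  pose Sc (w : T') := (S t i w (X (n0 + i)%N w) (Y (n0 + i)%N w))%:E.
  pose Qc (w : T') := Q t i w (1 - a).
  have mS : measurable_fun setT Sc.
    by apply/measurable_EFinP => _ V mV; rewrite setTI; exact: S_data.
  have mQ : measurable_fun setT Qc by move=> _ V mV; rewrite setTI; exact: Q_data.
  by have := measurable_lee measurableT mS mQ; rewrite setTI.
have C_anti t (w : T') i a b : a <= b -> C t w i b (Y (n0 + i)%N w) ->
    C t w i a (Y (n0 + i)%N w).
  by move=> ab; rewrite /C /conformal_set /= => /le_trans; apply; apply: Q_mono; lra.
have W0 t w i : 0 < \sum_l weight (D t w) i l.
  by apply: sum_ord_gt0 => l; apply: weight_gt0; exact: Hsigma.
have m_prob t i j : measurable_fun setT (fun w : T' => prob (D t w) i j).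
  exact: (@measurable_prob _ T' R k (alpha t) gamma (eta t) (sigma t) (C t)
    (fun w i => Y (n0 + i)%N w) (m_sets t) (C_anti t) i j (fun w => W0 t w i)).
have m_miss t i j : measurable_fun setT
    (fun w : T' => miss (D t w) i (level (D t w) i j)).
  have ml := @measurable_level _ T' R k (alpha t) gamma (eta t) (sigma t) (C t)
    (fun w i => Y (n0 + i)%N w) (m_sets t) i j.
  exact: (@measurable_miss_level _ T' R k (alpha t) gamma (eta t) (sigma t) (C t)
    (fun w i => Y (n0 + i)%N w) (m_sets t) i j ml).
have prob01 t i j w : 0 <= prob (D t w) i j <= 1.
  by rewrite prob_ge0 ?prob_le1//; exact: Hsigma.
have prob_sum t i w : \sum_j prob (D t w) i j = 1.
  by apply: sum_prob; exact: Hsigma.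
have slln t j := @conditional_slln _ _ T T' R P phi (fun i => [set w | J t i w = j])
  (fun i w => miss (D t w) i (level (D t w) i j)) (fun i w => prob (D t w) i j).
have m_prob_T t i j : measurable_fun setT (fun w : T => prob (D t w) i j).
  exact: (measurableT_comp (m_prob t i j) mphi).
have {}slln t j : {ae P, forall w, (fun n => n%:R^-1 * \sum_(i < n)
    (miss (D t w) i (level (D t w) i j) *
     (\1_[set w | J t i w = j] w - prob (D t w) i j))) @ \oo --> (0 : R)}.
  apply: slln => //.
  - by move=> i x; exact: miss01.
  (* The horizon i + 1 is the first that includes the selection at index i; for pairs it is m +
     1. *)
  - move=> i A mA; apply: (selection_single (n := i.+1) _ mJ m_prob_T) => //.
    + by rewrite -[X in measurable X]setTI; exact: mphi.
    + by move=> t' i' j' w; have /andP[] := prob01 t' i' j' w.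
    + by move=> j'; exact: PJ.
  - move=> i m A im mA; apply: (selection_pair (n := m.+1) _ mJ m_prob_T) => //.
    + by rewrite -[X in measurable X]setTI; exact: mphi.
    + by move=> t' i' j' w; have /andP[] := prob01 t' i' j' w.
    + by move=> j'; exact: PJ.
(* There are finitely many tails and indices, so a single null set serves for all of them. *)
have : {ae P, forall w, forall tj : bool * 'I_k.+1, (fun n => n%:R^-1 * \sum_(i < n)
    (miss (D tj.1 w) i (level (D tj.1 w) i tj.2) *
     (\1_[set w | J tj.1 i w = tj.2] w - prob (D tj.1 w) i tj.2))) @ \oo --> (0 : R)}.
  by apply: filter_forall => -[t j]; exact: slln.
apply: filterS => w slln_w.
have errE N : N%:R^-1 * \sum_(i < N) err_tot i w =
    N%:R^-1 * \sum_(i < N) (mean_miss (D lower w) i + mean_miss (D upper w) i) +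
    \sum_(tj : bool * 'I_k.+1) (N%:R^-1 * \sum_(i < N)
    (miss (D tj.1 w) i (level (D tj.1 w) i tj.2) *
     (\1_[set w | J tj.1 i w = tj.2] w - prob (D tj.1 w) i tj.2))).
  rewrite -mulr_sumr -mulrDr exchange_big/= -big_split/=; congr (_ * _).
  apply: eq_bigr => i _; rewrite -(pair_bigA _ (fun t j =>
    miss (D t w) i (level (D t w) i j) *
    (\1_[set w | J t i w = j] w - prob (D t w) i j)))/= big_bool.
  (* In the sum over j only the selected index has indicator 1; the subtracted probabilities cancel
     [mean_miss]. *)
  have tail t : miss (D t w) i (level (D t w) i (J t i w)) = mean_miss (D t w) i +
      \sum_j miss (D t w) i (level (D t w) i j) *
        (\1_[set w | J t i w = j] w - prob (D t w) i j).
    rewrite /mean_miss -big_split/= (bigD1 (J t i w))//= big1 => [|j jJ].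
      by rewrite indicE mem_set//=; ring.
    by rewrite indicE memNset/=; [ring|move=> Jj; rewrite Jj eqxx in jJ].
  by rewrite /err_tot !tail addrACA; congr (_ + _); exact: addrC.
rewrite (funext errE).
rewrite -[alpha_tot]addr0; apply: cvgD.
  exact: (average_total_miss_cvg (D := D ^~ w) (fun=> erefl)
    Halpha Hgamma Heta Hsigma (miss_lt0 w) (miss_gt1 w)).
rewrite [X in _ --> X](_ : 0 = \sum_(tj : bool * 'I_k.+1) 0); last by rewrite big1.
by apply: cvg_big => [|tj _]; [exact: add_continuous|exact: slln_w].
Qed.
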